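(* Let $f_0,f_1,\phi$ be continuous real functions and consider the system $$x_{n+1}=f_0(u_n)+f_1(u_n)\,x_n,\qquad u_{n+1}=\phi(u_n).$$ Suppose that $u=u_*$ is an attractive point of $u_{n+1}=\phi(u_n)$ and that $|f_1(u_* )|<1$. Then, for every initial condition $(x_0,u_0)$ with $x_0\in\mathbb{R}$ and $u_0$ in the basin of attraction of $u=u_*$, $$\lim_{n\to\infty}(x_n,u_n)=\left(\frac{f_0(u_* )}{1-f_1(u_* )},\,u_*\right).$$
   Context: The functions $f_0,f_1,\phi$ are defined and continuous on an open set $D\subseteq\mathbb{R}$ with $u_*\in D$; $\{x_n\},\{u_n\}$ are real sequences. That $u_*$ is an attractive point of $u_{n+1}=\phi(u_n)$ means that $u_*$ is a fixed point of $\phi$ which is a local stable attractor (Lyapunov stable, and all orbits starting sufficiently close to $u_*$ converge to $u_*$). The basin of attraction of $u=u_*$ is the set of $u_0$ whose orbit under $u_{n+1}=\phi(u_n)$ is well defined for all $n\ge 0$ (stays in $D$) and converges to $u_*$. *)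

(* Defs.v *)
From HB Require Import structures.
From mathcomp Require Import all_boot all_order all_algebra.
From mathcomp Require Import all_classical all_reals all_analysis.

Set Implicit Arguments.
Unset Strict Implicit.
Unset Printing Implicit Defensive.

Import Order.TTheory GRing.Theory Num.Theory.
Import numFieldNormedType.Exports.

Local Open Scope classical_set_scope.
Local Open Scope ring_scope.

(* A map defined on D is represented by a total function [phi : R -> R] whose
   values outside D carry no meaning; the orbit of u0 is well defined when it
   never leaves D. *)
Definition orbit_defined (R : realType) (D : set R) (phi : R -> R) (u0 : R) :
  Prop := forall n : nat, D (iter n phi u0).

Definition lyapunov_stable (R : realType) (D : set R) (phi : R -> R)
    (ustar : R) : Prop :=
  forall U : set R, nbhs ustar U ->
    \forall u0 \near ustar,
      orbit_defined D phi u0 /\ forall n : nat, U (iter n phi u0).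

Definition basin_of_attraction (R : realType) (D : set R) (phi : R -> R)
    (ustar : R) : set R :=
  [set u0 | orbit_defined D phi u0 /\ iter n phi u0 @[n --> \oo] --> ustar].

Definition attractive_point (R : realType) (D : set R) (phi : R -> R)
    (ustar : R) : Prop :=
  [/\ phi ustar = ustar,
      lyapunov_stable D phi ustar &
      \forall u0 \near ustar, basin_of_attraction D phi ustar u0].

(* Main.v *)
Require Import Defs.
From HB Require Import structures.
From mathcomp Require Import all_boot all_order all_algebra.
From mathcomp Require Import all_classical all_reals all_analysis.
From mathcomp Require Import lra ring.

Set Implicit Arguments.
Unset Strict Implicit.
Unset Printing Implicit Defensive.

Import Order.TTheory GRing.Theory Num.Theory.
Import numFieldNormedType.Exports.

Local Open Scope classical_set_scope.
Local Open Scope ring_scope.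

(** Along an orbit in the basin of attraction [u n] tends to [ustar], so by
    continuity the first coordinate obeys an affine recurrence whose
    coefficients converge, and whose limiting multiplier has modulus less
    than 1. Measuring [x] from the fixed point [L = f0 ustar / (1 - f1 ustar)]
    of the limiting affine map, the error [y = x - L] satisfies
    [y n.+1 = b n + f1 (u n) * y n], where
    [b n = f0 (u n) + f1 (u n) * L - L] tends to 0 because
    [f0 ustar + f1 ustar * L = L]. Past some rank [`|f1 (u n)|] stays below a
    fixed [q < 1], so [`|y|] is contracted by [q] up to a vanishing
    perturbation, and therefore tends to 0
    ([cvg0_perturbed_contraction]). *)

(** The value [e / (1 - q)] is the fixed point of [t |-> q * t + e]; hence
    [r n.+1 - e / (1 - q) <= q * (r n - e / (1 - q))]. *)
Lemma contraction_geometric_bound (R : realFieldType) (q e : R) (r : nat -> R) :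
  0 <= q < 1 -> 0 <= e -> (forall n, r n.+1 <= q * r n + e) -> 0 <= r 0%N ->
  forall n, r n <= q ^+ n * r 0%N + e / (1 - q).
Proof.
move=> /andP[q0 q1] e0 rS r0; have q1' : 0 < 1 - q by rewrite subr_gt0.
elim=> [|n IH]; first by rewrite expr0 mul1r lerDl divr_ge0// ltW.
apply: (le_trans (rS n)).
have -> : q ^+ n.+1 * r 0%N + e / (1 - q) =
          q * (q ^+ n * r 0%N + e / (1 - q)) + e.
  by rewrite exprS; field; rewrite gt_eqF.
by rewrite lerD2r ler_wpM2l.
Qed.

(** Once the perturbation is below [e * (1 - q) / 2], its accumulated effect
    is at most [e / 2], while the contribution of the past decays
    geometrically. *)
Lemma cvg0_perturbed_contraction (R : realType) (q : R) (r b : nat -> R) :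
  0 <= q < 1 -> (forall n, 0 <= r n) -> b @ \oo --> 0 ->
  (\forall n \near \oo, r n.+1 <= q * r n + b n) ->
  r @ \oo --> 0.
Proof.
move=> q01 r0 b0 rS; have /andP[q0 q1] := q01.
have q1' : 0 < 1 - q by rewrite subr_gt0.
move/cvgr0Pnorm_lt: b0 => b0; apply/cvgr0Pnorm_lt => e e0.
have d0 : 0 < e * (1 - q) / 2 by rewrite divr_gt0// mulr_gt0.
have [N _ HN] : \forall n \near \oo, r n.+1 <= q * r n + e * (1 - q) / 2.
  near=> n; apply: (@le_trans _ _ (q * r n + b n)); first by near: n.
  rewrite lerD2l (le_trans (ler_norm _))// ltW//.
  by near: n; exact: b0.
have bound k : r (N + k)%N <= q ^+ k * r N + e / 2.
  have -> : e / 2 = e * (1 - q) / 2 / (1 - q) by field; rewrite gt_eqF.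
  have := @contraction_geometric_bound R q _ (fun k => r (N + k)%N) q01 (ltW d0).
  rewrite /= addn0; apply=> // j.
  by rewrite addnS; apply: HN; rewrite /= leq_addr.
have geo : (fun k => q ^+ k * r N) @ \oo --> 0.
  rewrite -[X in _ --> X](mul0r (r N)); apply: cvgMr_tmp.
  by apply: cvg_expr; rewrite ger0_norm.
have e20 : 0 < e / 2 by rewrite divr_gt0.
have [M _ HM] := (cvgr0Pnorm_lt _).1 geo _ e20.
exists (N + M)%N => // n /= NMn.
have Nn : (N <= n)%N by rewrite (leq_trans _ NMn)// leq_addr.
rewrite ger0_norm// -(subnKC Nn) (le_lt_trans (bound _))//.
rewrite [ltRHS]splitr ltrD2r (le_lt_trans (ler_norm _))// HM//=.
by rewrite leq_subRL.
Unshelve. all: by end_near. Qed.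

(** The limit is the fixed point [L] of [t |-> b0 + a0 * t], and [`|x n - L|]
    undergoes a perturbed contraction. Any ratio strictly between [`|a0|] and 1
    eventually bounds the [`|a n|]; the proof takes the midpoint. *)
Lemma cvg_affine_recurrence (R : realType) (a0 b0 : R) (a b x : nat -> R) :
  `|a0| < 1 -> a @ \oo --> a0 -> b @ \oo --> b0 ->
  (forall n, x n.+1 = b n + a n * x n) ->
  x @ \oo --> b0 / (1 - a0).
Proof.
move=> a01 ca cb xS; set L := b0 / (1 - a0).
have a0n1 : 1 - a0 != 0.
  by rewrite subr_eq0; apply: contraTneq a01 => <-; rewrite normr1 ltxx.
have LE : b0 + a0 * L - L = 0 by rewrite /L; field.
have cc : (fun n => `|b n + a n * L - L|) @ \oo --> 0.
  rewrite -(normr0 R) -LE; apply: cvg_norm; apply: cvgB; last exact: cvg_cst.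
  by apply: cvgD => //; apply: cvgMr_tmp.
pose q := (`|a0| + 1) / 2.
have a0q : `|a0| < q by rewrite /q; lra.
have q01 : 0 <= q < 1.
  by have ? := normr_ge0 a0; rewrite /q; apply/andP; split; lra.
apply/subr_cvg0/norm_cvg0P.
apply: (cvg0_perturbed_contraction q01 _ cc) => [n|]; first exact: normr_ge0.
near=> n; rewrite xS.
have -> : b n + a n * x n - L = a n * (x n - L) + (b n + a n * L - L) by ring.
rewrite (le_trans (ler_normD _ _))// lerD2r normrM ler_wpM2r// ltW//.
by near: n; apply: (cvgr_lt `|a0|) => //; exact: cvg_norm.
Unshelve. all: by end_near. Qed.

Theorem proposition2 (R : realType) (D : set R) (f0 f1 phi : R -> R)
    (ustar : R)
    (openD : open D) (Dustar : D ustar)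
    (cf0 : {within D, continuous f0})
    (cf1 : {within D, continuous f1})
    (cphi : {within D, continuous phi})
    (attr : attractive_point D phi ustar)
    (f1_lt1 : `|f1 ustar| < 1)
    (x u : nat -> R)
    (xS : forall n : nat, x n.+1 = f0 (u n) + f1 (u n) * x n)
    (uS : forall n : nat, u n.+1 = phi (u n))
    (u0_basin : basin_of_attraction D phi ustar (u 0%N)) :
  (x n, u n) @[n --> \oo] --> (f0 ustar / (1 - f1 ustar), ustar).
Proof.
have uE n : iter n phi (u 0%N) = u n by elim: n => //= n ->; rewrite uS.
have cu : u @ \oo --> ustar.
  by case: u0_basin => _; apply: cvg_trans; under eq_fun do rewrite uE.
have continuous_ustar (f : R -> R) :
    {within D, continuous f} -> {for ustar, continuous f}.
  move=> cf; move: (cf); rewrite continuous_open_subspace// => /(_ ustar).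
  by apply; rewrite inE.
have cx : x @ \oo --> f0 ustar / (1 - f1 ustar).
  apply: cvg_affine_recurrence xS => //.
    exact: (cvg_comp _ _ cu (continuous_ustar _ cf1)).
  exact: (cvg_comp _ _ cu (continuous_ustar _ cf0)).
exact: (cvg_pair cx cu).
Qed.
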